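(* Let $\alpha:\mathbb{R}\to\mathrm{O}_n(\mathbb{R})$ be a quadratic rational curve with poles at $\pm\mathsf{i}$ and $\alpha(\infty)=I_n$. Then there exist $R\in\mathrm{O}_n(\mathbb{R})$, real numbers $2=\lambda_0>\lambda_1>\cdots>\lambda_r>0$ and integers $n_0\ge0$, $n_1,\dots,n_r>0$ such that $\alpha(t)=R\,\dfrac{t^2I_n+tA_1+A_0}{t^2+1}\,R^{\mathsf T}$, where $$A_1=\mathrm{diag}\left(\lambda_0\begin{bmatrix}0&I_{n_0}\\ -I_{n_0}&0\end{bmatrix},\lambda_1\begin{bmatrix}0&I_{2n_1}\\ -I_{2n_1}&0\end{bmatrix},\dots,\lambda_r\begin{bmatrix}0&I_{2n_r}\\ -I_{2n_r}&0\end{bmatrix},0,\dots,0\right),$$ $$A_0=\mathrm{diag}\left(-I_{2n_0},\mu_1\begin{bmatrix}H_1&G_1\\ G_1&-H_1\end{bmatrix}+\left(1-\tfrac{\lambda_1^2}{2}\right)I_{4n_1},\dots,\mu_r\begin{bmatrix}H_r&G_r\\ G_r&-H_r\end{bmatrix}+\left(1-\tfrac{\lambda_r^2}{2}\right)I_{4n_r},I_{n-2n_0-4\sum_{j=1}^rn_j}\right),$$ and for $1\le p\le r$ $$H_p=\mathrm{diag}\left(h_{p,1}\begin{bmatrix}0&1\\ -1&0\end{bmatrix},\dots,h_{p,n_p}\begin{bmatrix}0&1\\ -1&0\end{bmatrix}\right),\quad G_p=\mathrm{diag}\left(g_{p,1}\begin{bmatrix}0&1\\ -1&0\end{bmatrix},\dots,g_{p,n_p}\begin{bmatrix}0&1\\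 -1&0\end{bmatrix}\right),$$ $$\mu_p=\lambda_p\sqrt{1-\lambda_p^2/4},\qquad h_{p,1}^2+g_{p,1}^2=\cdots=h_{p,n_p}^2+g_{p,n_p}^2=1,$$ with $h_{p,j},g_{p,j}\in\mathbb{R}$.
   Context: $\mathrm{O}_n(\mathbb{R})=\{X\in\mathrm{GL}_n(\mathbb{R}):X^{\mathsf T}X=I_n\}$; $\mathsf{i}$ is the complex unit. A rational curve on $\mathrm{O}_n(\mathbb{R})$ is a map $\gamma(t)=P(t)/q(t)$, with $q\in\mathbb{R}[t]$ having no real root, $P\in\mathbb{R}[t]^{n\times n}$, $q$ and the entries of $P$ having gcd $1$, $\gamma(t)\in\mathrm{O}_n(\mathbb{R})$ for all real $t$, and $\gamma(+\infty)=\gamma(-\infty)\in\mathrm{O}_n(\mathbb{R})$. Its degree is $\deg q$ (quadratic means degree $2$) and its poles are the complex roots of $q$. *)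

(* Defs.v *)
From HB Require Import structures.
From mathcomp Require Import all_boot all_order all_algebra.
From mathcomp Require Import complex.
From mathcomp Require Import all_classical all_reals all_analysis.

Set Implicit Arguments.
Unset Strict Implicit.
Unset Printing Implicit Defensive.

Import Order.TTheory GRing.Theory Num.Theory.
Import numFieldNormedType.Exports.

Local Open Scope classical_set_scope.
Local Open Scope ring_scope.

Definition orthogonal_group (R : realType) (n : nat) : set 'M[R]_n :=
  [set X | X \in unitmx /\ X^T *m X = 1%:M].

Definition curve_eval (R : realType) (n : nat)
    (P : 'M[{poly R}]_n) (q : {poly R}) (t : R) : 'M[R]_n :=
  \matrix_(i, j) ((P i j).[t] / q.[t]).

(* The fraction P / q is part of the data; being reduced, it is determined by
   the underlying function up to a common nonzero scalar, so that the degree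
   and the poles below only depend on that function. *)
Record rational_curve (R : realType) (n : nat) := RationalCurve {
  curve_num : 'M[{poly R}]_n;
  curve_den : {poly R};
  curve_infty : 'M[R]_n;
  curve_den_noroot : forall t : R, ~~ root curve_den t;
  curve_reduced : coprimep curve_den
    (\big[@gcdp R/0]_(i < n) \big[@gcdp R/0]_(j < n) curve_num i j);
  curve_orthogonal :
    forall t : R, @orthogonal_group R n (curve_eval curve_num curve_den t);
  curve_infty_orthogonal : @orthogonal_group R n curve_infty;
  curve_cvg_pinfty :
    curve_eval curve_num curve_den t @[t --> +oo] --> curve_infty;
  curve_cvg_ninfty :
    curve_eval curve_num curve_den t @[t --> -oo] --> curve_infty
}.

Definition curve_fun (R : realType) (n : nat) (c : rational_curve R n) (t : R) :
    'M[R]_n :=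
  curve_eval (curve_num c) (curve_den c) t.

Coercion curve_fun : rational_curve >-> Funclass.

Definition curve_degree (R : realType) (n : nat) (c : rational_curve R n) : nat :=
  (size (curve_den c)).-1.

Definition curve_poles (R : realType) (n : nat) (c : rational_curve R n) :
    set R[i] :=
  [set z | root (map_poly (real_complex R) (curve_den c)) z].

Definition dsum_mx (R : realType) (k l : nat) (A : 'M[R]_k) (B : 'M[R]_l) :
    'M[R]_(k + l) :=
  block_mx A 0 0 B.

Definition skew_unit (R : realType) (k : nat) : 'M[R]_(k + k) :=
  block_mx 0 1%:M (- 1%:M) 0.

Lemma sum_two (k : nat) : (\sum_(j < k) 2 = 2 * k)%N.
Proof. by rewrite sum_nat_const card_ord mulnC. Qed.

(* diag(c 0 *: J, ..., c k.-1 *: J) with J = [0 1; -1 0] *)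
Definition skew_diag (R : realType) (k : nat) (c : nat -> R) : 'M[R]_(2 * k) :=
  castmx (sum_two k, sum_two k)
    (\mxdiag_(j < k) (c j *: (skew_unit R 1 : 'M[R]_2))).

Definition mu (R : realType) (l : R) : R := l * Num.sqrt (1 - l ^+ 2 / 4%:R).

Definition A0_block (R : realType) (k : nat) (l : R) (h g : nat -> R) :
    'M[R]_(2 * k + 2 * k) :=
  let H := skew_diag k h in
  let G := skew_diag k g in
  mu l *: block_mx H G G (- H) + (1 - l ^+ 2 / 2%:R)%:M.

(* In the normal forms, [N 0 = n_0], [N p = n_p], and [m] is the size of the
   trailing block. The blocks of index 1, ..., r are indexed by [p < r]
   through [p.+1]; the second index of [h] and [g] starts from 0. *)
Definition normal_size (r : nat) (N : nat -> nat) (m : nat) : nat :=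
  ((N 0 + N 0) + (\sum_(p < r) (2 * N p.+1 + 2 * N p.+1) + m))%N.

Definition normal_A1 (R : realType) (r : nat) (N : nat -> nat) (m : nat)
    (lam : nat -> R) : 'M[R]_(normal_size r N m) :=
  dsum_mx (lam 0%N *: skew_unit R (N 0%N))
    (dsum_mx (\mxdiag_(p < r) (lam p.+1 *: skew_unit R (2 * N p.+1)%N))
      (0 : 'M[R]_m)).

Definition normal_A0 (R : realType) (r : nat) (N : nat -> nat) (m : nat)
    (lam : nat -> R) (h g : nat -> nat -> R) : 'M[R]_(normal_size r N m) :=
  dsum_mx (- 1%:M : 'M[R]_(N 0 + N 0)%N)
    (dsum_mx
      (\mxdiag_(p < r) A0_block (N p.+1) (lam p.+1) (h p.+1) (g p.+1))
      (1%:M : 'M[R]_m)).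

(* Main.v *)
Require Import Defs.
From HB Require Import structures.
From mathcomp Require Import all_boot all_order all_algebra.
From mathcomp Require Import complex polyrcf.
From mathcomp Require Import all_classical all_reals all_analysis.
From mathcomp Require Import ring lra zify.

Set Implicit Arguments.
Unset Strict Implicit.
Unset Printing Implicit Defensive.

Import Order.TTheory GRing.Theory Num.Theory.
Import numFieldNormedType.Exports.

Local Open Scope classical_set_scope.
Local Open Scope ring_scope.

(* Orthogonality of [t^2 I + t A + B] up to the factor [t^2 + 1], for all [t],
   means that [A] is skew and [B = I + A^2/2 + K] with [K] skew,
   [K A = - A K] and [K^2 = A^2 + A^4/4]. The symmetric matrix [S = - A^2]
   is diagonalizable and commutes with [A] and [K]; positivity of [- A^2] and
   [- K^2] puts its eigenvalues in [[0, 4]]. For the eigenvalue [0] both [A]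
   and [K] vanish; for [4], [A/2] is a complex structure and [K] vanishes; for
   the others, [A] and [K] normalize to two anticommuting complex structures,
   so the eigenspace is a quaternionic space, which has an orthonormal
   quaternionic basis. Throughout, bases are rows and matrices act on the
   right; all blocks are obtained with [h = 1] and [g = 0]. *)

(** * Orthonormal families of rows and the real spectral theorem *)

Lemma mulmx_trmx_eq0 (R : realDomainType) m n (Y : 'M[R]_(m, n)) :
  Y *m Y^T = 0 -> Y = 0.
Proof.
move=> Y0; apply/matrixP => i j; rewrite mxE; apply/eqP.
have /eqP := congr1 (fun M : 'M[R]_m => M i i) Y0; rewrite !mxE psumr_eq0.
  by move=> /allP/(_ j (mem_index_enum j))/=; rewrite mxE mulf_eq0 orbb.
by move=> k _; rewrite mxE -expr2 sqr_ge0.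
Qed.

Lemma leq_orthonormal_rows (F : fieldType) k n (W : 'M[F]_(k, n)) :
  W *m W^T = 1%:M -> (k <= n)%N.
Proof.
by move=> WW; rewrite -(mxrank1 F k) -WW (leq_trans (mxrankM_maxl _ _)) ?rank_leq_col.
Qed.

Lemma skew_row_eq0 (F : numFieldType) n (X : 'M[F]_n) (v : 'rV[F]_n) :
  X^T = - X -> v *m X *m v^T = 0.
Proof.
move=> XT; apply/matrixP => i j; rewrite mxE.
have : (v *m X *m v^T)^T = - (v *m X *m v^T).
  by rewrite !trmx_mul trmxK XT mulNmx mulmxN mulmxA.
move=> /matrixP/(_ i j); rewrite !ord1 !mxE => e; apply/eqP.
by rewrite -[_ == 0](mulrn_eq0 _ 2)/= mulr2n {2}e subrr.
Qed.

(** A dimension count: [row_base V *m Y^T] has more rows than columns, so its kernel is nonzero; a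
    nonzero kernel vector gives a row of [V] orthogonal to [Y], which is then normalized. *)
Lemma exists_orthogonal_unit (R : rcfType) m k n
    (V : 'M[R]_(m, n)) (Y : 'M[R]_(k, n)) : (k < \rank V)%N ->
  exists v : 'rV[R]_n, [/\ v *m v^T = 1%:M, (v <= V)%MS & v *m Y^T = 0].
Proof.
move=> ltkV; have : kermx (row_base V *m Y^T) != 0.
  by rewrite -mxrank_eq0 mxrank_ker -lt0n subn_gt0 (leq_ltn_trans (rank_leq_col _)).
move=> /rowV0Pn[u /sub_kermxP uY u0]; pose v := u *m row_base V.
have v0 : v != 0 by rewrite mulmx_free_eq0// row_base_free.
pose s := \sum_j v 0 j ^+ 2.
have vv : v *m v^T = s%:M.
  rewrite /s; move: (v) => w; apply/matrixP => i j; rewrite !ord1 !mxE mulr1n.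
  by apply: eq_bigr => l _; rewrite mxE -expr2.
have s_gt0 : 0 < s.
  rewrite lt_def sumr_ge0 ?andbT => [|j _]; last exact: sqr_ge0.
  apply: contra_neq v0 => s0; by apply: mulmx_trmx_eq0; rewrite vv s0 raddf0.
exists ((Num.sqrt s)^-1 *: v); split.
- rewrite -scalemxAl linearZ/= -scalemxAr scalerA vv -expr2 exprVn.
  by rewrite sqr_sqrtr ?ltW// scale_scalar_mx mulVf ?gt_eqF.
- by rewrite scalemx_sub// mulmx_sub ?eq_row_base.
- by rewrite -scalemxAl /v -mulmxA uY scaler0.
Qed.

(* A maximal family of rows works: as long as its orbit has rank less than [V],
   some unit row of [V] is orthogonal to the whole orbit, and by skewness it
   is orthogonal to its own images. *)
Lemma orthonormal_orbit (R : rcfType) n d (X : 'I_d -> 'M[R]_n) (V : 'M[R]_n) :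
  (forall i, (X i)^T = - X i) ->
  exists k (W : 'M[R]_(k, n)), [/\ W *m W^T = 1%:M,
    forall i, W *m X i *m W^T = 0, (W <= V)%MS & (\rank V <= d.+1 * k)%N].
Proof.
move=> XT.
have step c : forall k (W : 'M[R]_(k, n)), (n <= k + c)%N -> W *m W^T = 1%:M ->
    (forall i, W *m X i *m W^T = 0) -> (W <= V)%MS ->
  exists k (W : 'M[R]_(k, n)), [/\ W *m W^T = 1%:M,
    forall i, W *m X i *m W^T = 0, (W <= V)%MS & (\rank V <= d.+1 * k)%N].
  (* Here [c] bounds the number of rows that can still be added: when it reaches 0, [n <= k] already
     bounds the rank of [V]. *)
  elim: c => [|c IHc] k W lenk W1 WX WV.
    exists k, W; split=> //; rewrite addn0 in lenk.
    by rewrite (leq_trans (rank_leq_col V))// (leq_trans lenk)// leq_pmull.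
  have [leV|ltV] := leqP (\rank V) (d.+1 * k); first by exists k, W.
  pose Y := col_mx W (\mxcol_(i < d) (W *m X i)).
  have ltY : (k + \sum_(i < d) k < \rank V)%N.
    by rewrite sum_nat_const card_ord -mulSn.
  have [v [v1 vV vY]] := exists_orthogonal_unit Y ltY.
  move: vY; rewrite tr_col_mx mul_mx_row -row_mx0 => /eq_row_mx[vW].
  rewrite tr_mxcol mul_mxrow => vX.
  have {}vX i : v *m X i *m W^T = 0.
    have := congr1 (fun M => submxrow M i) vX.
    rewrite mxrowK submxrow0 trmx_mul XT mulNmx mulmxN mulmxA.
    by move=> /eqP; rewrite oppr_eq0 => /eqP.
  have Wv : W *m v^T = 0 by rewrite -[LHS]trmxK trmx_mul trmxK vW trmx0.
  apply: (IHc (1 + k)%N (col_mx v W)); first by rewrite add1n addSnnS.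
  - by rewrite tr_col_mx mul_col_row v1 vW Wv W1 -scalar_mx_block.
  - move=> i; rewrite mul_col_mx tr_col_mx mul_col_row vX WX skew_row_eq0//.
    rewrite (_ : W *m X i *m v^T = 0) ?block_mx0//.
    apply: trmx_inj; rewrite !trmx_mul trmxK XT mulNmx mulmxN mulmxA vX.
    by rewrite oppr0 trmx0.
  - by rewrite col_mx_sub vV.
apply: (step n 0%N 0); rewrite ?sub0mx//.
  by apply/matrixP => -[].
by move=> i; apply/matrixP => -[].
Qed.

(** Over [R[i]] the matrix [S] is hermitian, so it is unitarily diagonalizable with real
    eigenvalues. Each row of the diagonalizing matrix lies in an eigenspace of [S] extended to
    [R[i]], and inclusions of row spaces descend to [R]. *)
Lemma symmetric_eigenspaces (R : rcfType) n (S : 'M[R]_n) : S^T = S ->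
  exists rs : seq R, (1%:M <= \sum_(a <- rs) eigenspace S a)%MS.
Proof.
move=> ST; pose f := @real_complex R.
pose Sc := map_mx f S : 'M[R[i]]_n.
have Sh : Sc \is hermsymmx.
  apply: realsym_hermsym.
    apply/is_hermitianmxP; rewrite expr0 scale1r map_mx_id//.
    by apply/matrixP => i j; rewrite !mxE -{1}ST mxE.
  by apply/mxOverP => i j; rewrite mxE complex_real.
have /orthomx_spectralP := hermitian_normalmx Sh.
set P := spectralmx Sc; set D := spectral_diag Sc => eqS.
have Pu : P \in unitmx by exact: spectral_unit.
have /mxOverP Dr := hermitian_spectral_diag_real Sh.
exists [seq complex.Re (D 0 i) | i : 'I_n].
rewrite -(map_submx f) map_mx1.
apply: (@submx_trans _ _ _ _ _ _ P); first by rewrite submx_full// row_full_unit.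
apply/row_subP => i.
have DE : f (complex.Re (D 0 i)) = D 0 i.
  by have := Dr 0 i; case/complex_realP => x ->.
apply: (@submx_trans _ _ _ _ _ _ (map_mx f (eigenspace S (complex.Re (D 0 i))))).
  rewrite map_eigenspace; apply/eigenspaceP; rewrite [X in X *: _]DE.
  rewrite -/Sc eqS !mulmxA -row_mul mulmxV// row1 -rowE row_diag_mx.
  by rewrite -scalemxAl -rowE.
rewrite map_submx; rewrite big_image/= (bigD1 i)//=; exact: addsmxSl.
Qed.

(** * Interleaved pairs of rows *)

(** The row order matching [skew_diag]: [row j C] and [row j D] are adjacent, so that one 2 by 2
    block acts on the pair. *)
Definition interleave (R : realType) k n (C D : 'M[R]_(k, n)) :
    'M[R]_(2 * k, n) :=
  castmx (sum_two k, erefl n) (\mxcol_(j < k) col_mx (row j C) (row j D)).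

Lemma skew_unit_mul (R : realType) k n (E F : 'M[R]_(k, n)) :
  skew_unit R k *m col_mx E F = col_mx F (- E).
Proof.
by rewrite mul_block_col !mul0mx add0r addr0 mul1mx mulNmx mul1mx.
Qed.

Section Interleave.
Variables (R : realType) (k n : nat).
Implicit Types (C D : 'M[R]_(k, n)).

Lemma interleave_mul p C D (X : 'M[R]_(n, p)) :
  interleave C D *m X = interleave (C *m X) (D *m X).
Proof.
rewrite /interleave; case: _ / (sum_two k); rewrite !castmx_id mxcol_mul.
by apply: eq_mxcol => j; rewrite (mul_col_mx (row j C) (row j D)) !row_mul.
Qed.

Lemma interleaveZ a C D : a *: interleave C D = interleave (a *: C) (a *: D).
Proof.
rewrite -[in LHS]mul_scalar_mx /interleave; case: _ / (sum_two k).
rewrite !castmx_id -mxdiagZ mul_mxdiag_mxcol; apply: eq_mxcol => j.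
by rewrite mul_scalar_mx (scale_col_mx a (row j C) (row j D)) !linearZ.
Qed.

Lemma skew_diag_interleave c C D :
  skew_diag k (fun=> c) *m interleave C D = interleave (c *: D) (- (c *: C)).
Proof.
rewrite /skew_diag /interleave; case: _ / (sum_two k); rewrite !castmx_id.
rewrite mul_mxdiag_mxcol; apply: eq_mxcol => j.
rewrite -scalemxAl (skew_unit_mul (row j C)).
by rewrite (scale_col_mx c (row j D)) scalerN !linearN !linearZ.
Qed.

(** Serves with [s = 1] for orthonormality and with [s = 0] for orthogonality of two interleaved
    families. *)
Lemma interleave_gram s C C' D D' :
    C *m C'^T = s%:M -> D *m D'^T = s%:M -> C *m D'^T = 0 -> D *m C'^T = 0 ->
  interleave C D *m (interleave C' D')^T = s%:M.
Proof.
move=> CC DD CD DC.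
have rr (M N : 'M[R]_(k, n)) i j : row i M *m (row j N)^T = ((M *m N^T) i j)%:M.
  by rewrite -row_mul; apply/matrixP => a b; rewrite !ord1 !mxE mulr1n;
     apply: eq_bigr => l _; rewrite !mxE.
rewrite /interleave; case: _ / (sum_two k); rewrite !castmx_id.
rewrite tr_mxcol mul_mxcol_mxrow -mxdiagZ; apply: eq_mxblock => i j.
rewrite (tr_col_mx (row j C')).
apply: (etrans (mul_col_row (row i C) (row i D) (row j C')^T (row j D')^T)).
rewrite !rr CC DD CD DC !mxE raddf0.
case: eqVneq => _; last by rewrite raddf0 block_mx0.
by rewrite conform_mx_id -scalar_mx_block.
Qed.

End Interleave.

(** * Adapted bases of the eigenspaces of [- A^2] *)

Section SkewPair.
Variables (R : realType) (n : nat) (A K : 'M[R]_n).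
Hypotheses (AT : A^T = - A) (KT : K^T = - K) (KA : K *m A = - (A *m K)).
Hypothesis KK : K *m K = A *m A + 4^-1 *: (A *m A *m (A *m A)).

Let S := - (A *m A).
Let A0 := 1%:M + 2^-1 *: (A *m A) + K.

Lemma neg_sqr_skew_sym : S^T = S.
Proof. by rewrite /S linearN /= trmx_mul AT mulNmx mulmxN opprK. Qed.

Section Eigenrows.
Variables (k : nat) (a : R) (Y : 'M[R]_(k, n)).
Hypothesis YS : Y *m S = a *: Y.

Lemma eigenrow_AA : Y *m A *m A = - (a *: Y).
Proof. by rewrite -YS /S mulmxN opprK mulmxA. Qed.

(** As [A^2] acts on [Y] by [- a], the relation for [K^2] makes it act by [- a + a^2 / 4]. *)
Lemma eigenrow_KK : Y *m K *m K = - ((a * (1 - a / 4)) *: Y).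
Proof.
rewrite -mulmxA KK mulmxDr -scalemxAr !mulmxA !(eigenrow_AA, mulNmx, =^~scalemxAl).
rewrite !scalerN opprK !scalerA -!(scaleNr _ Y) -scalerDl; congr (_ *: _).
by field.
Qed.

Lemma eigenrow_A0 : Y *m A0 = (1 - a / 2) *: Y + Y *m K.
Proof.
rewrite !mulmxDr mulmx1 -scalemxAr mulmxA eigenrow_AA scalerBl scale1r scalerN.
by rewrite scalerA mulrC.
Qed.

Lemma eigenrow_gram_A : Y *m A *m (Y *m A)^T = a *: (Y *m Y^T).
Proof.
by rewrite trmx_mul AT mulNmx mulmxN mulmxA eigenrow_AA mulNmx opprK scalemxAl.
Qed.

Lemma eigenrow_gram_K :
  Y *m K *m (Y *m K)^T = (a * (1 - a / 4)) *: (Y *m Y^T).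
Proof.
by rewrite trmx_mul KT mulNmx mulmxN mulmxA eigenrow_KK mulNmx opprK scalemxAl.
Qed.

Lemma eigenrow_stable_A : Y *m A *m S = a *: (Y *m A).
Proof.
by rewrite /S mulmxN mulmxA eigenrow_AA mulNmx opprK -scalemxAl.
Qed.

(** Two sign changes cancel, so [K] commutes with [A^2]. *)
Lemma eigenrow_stable_K : Y *m K *m S = a *: (Y *m K).
Proof.
have AAK : A *m A *m K = K *m (A *m A).
  by rewrite [RHS]mulmxA KA mulNmx -[in RHS]mulmxA KA mulmxN opprK mulmxA.
by rewrite -mulmxA /S mulmxN -AAK -mulNmx mulmxA -/S YS -scalemxAl.
Qed.

End Eigenrows.

(** The squared norms of [v *m A] and [v *m K] are that of [v] times [a] and [a * (1 - a / 4)]; both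
    factors are therefore nonnegative. *)
Lemma eigenvalue_bounds a : eigenspace S a != 0 -> 0 <= a <= 4.
Proof.
move=> /rowV0Pn[v /eigenspaceP vS v0].
have sq_ge0 (w : 'rV[R]_n) : 0 <= (w *m w^T) 0 0.
  by rewrite mxE sumr_ge0// => j _; rewrite mxE -expr2 sqr_ge0.
have s_gt0 : 0 < (v *m v^T) 0 0.
  rewrite lt_def sq_ge0 andbT; apply: contra_neq v0 => v0.
  by apply: mulmx_trmx_eq0; apply/matrixP => i j; rewrite !ord1 v0 mxE.
have := sq_ge0 (v *m A); have := sq_ge0 (v *m K).
rewrite (eigenrow_gram_A vS) (eigenrow_gram_K vS).
have scE c : (c *: (v *m v^T)) 0 0 = c * (v *m v^T) 0 0 by rewrite [LHS]mxE.
rewrite !scE !(pmulr_lge0 _ s_gt0) => aK a_ge0; rewrite a_ge0/=.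
case: (lerP a 4) aK => // a_gt4; rewrite pmulr_rge0; last exact: lt_trans a_gt4.
by rewrite subr_ge0 ler_pdivrMr// mul1r leNgt a_gt4.
Qed.

(* The rank condition is only an inequality: summed over all eigenvalues, it
   forces the orthonormal rows to be [n] in number. *)
Definition adapted a k (B1 B0 : 'M[R]_k) (Y : 'M[R]_(k, n)) : Prop :=
  [/\ Y *m Y^T = 1%:M, Y *m S = a *: Y, Y *m A = B1 *m Y, Y *m A0 = B0 *m Y
    & (\rank (eigenspace S a) <= k)%N].

(** With [d = 0], [orthonormal_orbit] yields an orthonormal basis of the eigenspace; the Gram
    matrices of its images under [A] and [K] carry the factor [a = 0], so these images vanish. *)
Lemma adapted_kernel : exists k (Y : 'M[R]_(k, n)), adapted 0 0 1%:M Y.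
Proof.
have [|k [W [W1 _ /eigenspaceP WS rk]]] :=
  @orthonormal_orbit R n 0 (fun=> 0) (eigenspace S 0); first by case.
exists k, W; split=> //; last by rewrite mul1n in rk.
  rewrite mul0mx; apply: mulmx_trmx_eq0.
  by rewrite (eigenrow_gram_A WS) scale0r.
rewrite (eigenrow_A0 WS) mul0r subr0 scale1r mul1mx.
suff -> : W *m K = 0 by rewrite addr0.
by apply: mulmx_trmx_eq0; rewrite (eigenrow_gram_K WS) mul0r scale0r.
Qed.

(** The orbit of [W] under the single matrix [A] fills the eigenspace: [W] and [W A / 2] form an
    orthonormal basis, on which [A] acts as twice a complex structure. The block of [A0] comes from
    [1 - a / 2 = -1]. *)
Lemma adapted_involution : exists k (Y : 'M[R]_(k + k, n)),
  adapted 4 (2 *: skew_unit R k) (- 1%:M) Y.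
Proof.
have [|k [W [W1 WA /eigenspaceP WS rk]]] :=
  @orthonormal_orbit R n 1 (fun=> A) (eigenspace S 4); first by [].
have {}WA : W *m A *m W^T = 0 := WA ord0.
pose Y := col_mx W (2^-1 *: (W *m A)).
have YS : Y *m S = 4 *: Y.
  by rewrite mul_col_mx -scalemxAl (eigenrow_stable_A WS) WS scale_col_mx !scalerA mulrC.
exists k, Y; split=> //; last by rewrite addnn -mul2n.
- rewrite tr_col_mx mul_col_row !linearZ/= -?scalemxAl -?scalemxAr WA.
  rewrite (eigenrow_gram_A WS) W1 trmx_mul AT mulNmx mulmxN mulmxA WA.
  rewrite oppr0 !scaler0 !scalerA (_ : 2^-1 * 2^-1 * 4 = 1 :> R); last by field.
  by rewrite scale1r -scalar_mx_block.
- rewrite -scalemxAl skew_unit_mul mul_col_mx -scalemxAl (eigenrow_AA WS).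
  rewrite scale_col_mx scalerA divff ?pnatr_eq0// scale1r !scalerN scalerA.
  by congr (col_mx _ (- (_ *: _))); field.
- rewrite (eigenrow_A0 YS) (_ : Y *m K = 0).
    by rewrite addr0 mulNmx mul1mx -(scaleN1r Y); congr (_ *: _); field.
  apply: mulmx_trmx_eq0; rewrite (eigenrow_gram_K YS) divff ?pnatr_eq0//.
  by rewrite subrr mulr0 scale0r.
Qed.

(** With [W] as quaternionic basis, the rows of [W], [W K / m], [W A / l] and [W K A / (l m)] form
    an orthonormal real basis. Pairing by [K] inside each half produces [H]; pairing the two halves
    by [A] produces the block of [A1]. *)
Lemma adapted_quaternionic a : 0 < a -> a < 4 ->
  exists k (Y : 'M[R]_(2 * k + 2 * k, n)),
  adapted a (Num.sqrt a *: skew_unit R (2 * k))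
    (A0_block k (Num.sqrt a) (fun=> 1) (fun=> 0)) Y.
Proof.
move=> a_gt0 a_lt4.
(* The default value of [nth] supplies the third entry [A *m K], which is skew because [A] and [K]
   anticommute. *)
pose X (i : 'I_3) := nth (A *m K) [:: A; K] i.
have XT i : (X i)^T = - X i.
  case: i => [[|[|i]] lti]; rewrite /X //= nth_nil.
  by rewrite trmx_mul AT KT mulNmx mulmxN opprK KA.
have [k [W [W1 WX /eigenspaceP WS rk]]] := orthonormal_orbit (eigenspace S a) XT.
have WA : W *m A *m W^T = 0 := WX (@Ordinal 3 0 isT).
have WK : W *m K *m W^T = 0 := WX (@Ordinal 3 1 isT).
have WAK : W *m A *m K *m W^T = 0.
  by rewrite -[W *m A *m K]mulmxA; exact: WX (@Ordinal 3 2 isT).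
set l := Num.sqrt a; pose m := Num.sqrt (a * (1 - a / 4)).
have l2 : l * l = a by rewrite -expr2 sqr_sqrtr// ltW.
have l0 : l != 0 by rewrite gt_eqF// sqrtr_gt0.
have m_gt0 : 0 < a * (1 - a / 4).
  by rewrite mulr_gt0// subr_gt0 ltr_pdivrMr// mul1r.
have m2 : m * m = a * (1 - a / 4) by rewrite -expr2 sqr_sqrtr// ltW.
have m0 : m != 0 by rewrite gt_eqF// sqrtr_gt0.
have muE : mu l = m.
  by rewrite /mu expr2 l2 /m sqrtrM// ltW.
pose U := interleave W (m^-1 *: (W *m K)).
have US : U *m S = a *: U.
  by rewrite interleave_mul interleaveZ -scalemxAl (eigenrow_stable_K WS) WS !scalerA mulrC.
have UU : U *m U^T = 1%:M.
  apply: interleave_gram; rewrite // ?linearZ/= -?scalemxAl -?scalemxAr.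
  - rewrite (eigenrow_gram_K WS) W1 -m2 !scalerA -mulrA.
    by rewrite [_ * (m * m)]mulrA mulVf// mul1r mulVf// scale1r.
  - by rewrite trmx_mul KT mulNmx mulmxN mulmxA WK oppr0 scaler0.
  - by rewrite WK scaler0.
(* Anticommutation and the formula for [K^2] reduce the four products to [W *m A *m W^T] and
   [W *m A *m K *m W^T]. *)
have UA : U *m A *m U^T = 0.
  rewrite interleave_mul -[RHS](raddf0 (@scalar_mx R (2 * k))).
  apply: interleave_gram; rewrite ?linearZ/= -?scalemxAl -?scalemxAr ?raddf0.
  - by [].
  - rewrite -[W *m K *m A]mulmxA KA trmx_mul KT !(mulNmx, mulmxN) opprK.
    rewrite !mulmxA (eigenrow_KK (eigenrow_stable_A WS)) mulNmx -scalemxAl WA.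
    by rewrite scaler0 oppr0 !scaler0.
  - by rewrite trmx_mul KT mulNmx mulmxN mulmxA WAK oppr0 scaler0.
  - by rewrite -[W *m K *m A]mulmxA KA mulmxN mulmxA mulNmx WAK oppr0 scaler0.
have UK : U *m K = m *: (skew_diag k (fun=> 1) *m U).
  rewrite skew_diag_interleave interleaveZ interleave_mul -scalemxAl.
  rewrite (eigenrow_KK WS) scale1r scalerA mulfV// scale1r -m2.
  by rewrite !scalerN scalerA mulrA mulVf// mul1r scale1r.
(* The sign from anticommutation is the source of the block [- H]. *)
have UAK : U *m A *m K = - (m *: (skew_diag k (fun=> 1) *m (U *m A))).
  by rewrite -mulmxA -[A *m K]opprK -KA mulmxN [U *m (K *m A)]mulmxA UK -scalemxAl mulmxA.
have skew0 : skew_diag k (fun=> 0) = 0 :> 'M[R]_(2 * k).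
  rewrite /skew_diag; case: _ / (sum_two k); rewrite castmx_id.
  by under eq_mxdiag do rewrite scale0r; rewrite mxdiag0.
pose Y := col_mx U (l^-1 *: (U *m A)).
have YS : Y *m S = a *: Y.
  by rewrite mul_col_mx -scalemxAl (eigenrow_stable_A US) US scale_col_mx !scalerA mulrC.
exists k, Y; split=> //; last by rewrite addnn -mul2n mulnA.
- rewrite tr_col_mx mul_col_row !linearZ/= -?scalemxAl -?scalemxAr UA.
  rewrite (eigenrow_gram_A US) UU trmx_mul AT mulNmx mulmxN mulmxA UA.
  rewrite oppr0 !scaler0 !scalerA -l2 -mulrA [_ * (l * l)]mulrA mulVf//.
  by rewrite mul1r mulVf// scale1r -scalar_mx_block.
- rewrite -scalemxAl skew_unit_mul mul_col_mx -scalemxAl (eigenrow_AA US).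
  rewrite scale_col_mx scalerA divff// scale1r !scalerN scalerA.
  by rewrite -l2 mulrA mulVf// mul1r.
- rewrite (eigenrow_A0 YS) /A0_block muE skew0 expr2 l2 mulmxDl mul_scalar_mx.
  rewrite addrC; congr (_ + _); rewrite -scalemxAl mul_block_col !mul0mx addr0 add0r.
  rewrite scale_col_mx mul_col_mx UK -scalemxAl UAK; congr col_mx.
  by rewrite mulNmx -scalemxAr !scalerN scalerA mulrC -scalerA.
Qed.

End SkewPair.

(** * Gluing the eigenspaces into one orthonormal frame *)

Section Assembly.
Variables (R : realType) (n : nat) (A K : 'M[R]_n).
Hypotheses (AT : A^T = - A) (KT : K^T = - K) (KA : K *m A = - (A *m K)).
Hypothesis KK : K *m K = A *m A + 4^-1 *: (A *m A *m (A *m A)).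

Let S := - (A *m A).
Let A0 := 1%:M + 2^-1 *: (A *m A) + K.

Lemma eigenrows_orthogonal k l (Y : 'M[R]_(k, n)) (Z : 'M[R]_(l, n)) a b :
  a != b -> Y *m S = a *: Y -> Z *m S = b *: Z -> Y *m Z^T = 0.
Proof.
move=> ab YS ZS; have : (a - b) *: (Y *m Z^T) == 0.
  rewrite scalerBl scalemxAl -YS scalemxAr -[b *: Z^T]linearZ/= -ZS trmx_mul.
  by rewrite (neg_sqr_skew_sym AT) mulmxA subrr.
by rewrite scaler_eq0 subr_eq0 (negPf ab) => /eqP.
Qed.

(** The rows of [B] are the adapted bases for 4, for the eigenvalues strictly between 0 and 4 in
    decreasing order, and for 0. As [B] has [normal_size r N m] rows, the equality of this size with
    [n] can come as a conclusion. *)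
Lemma skew_pair_normal_form :
  exists (r : nat) (lam : nat -> R) (N : nat -> nat) (h g : nat -> nat -> R)
    (m : nat) (B : 'M[R]_(normal_size r N m, n)),
  [/\ [/\ B *m B^T = 1%:M, B *m A = normal_A1 r N m lam *m B,
          B *m A0 = normal_A0 r N m lam h g *m B & normal_size r N m = n],
      [/\ lam 0%N = 2%:R, forall p, (p < r)%N -> lam p.+1 < lam p & 0 < lam r],
      forall p, (1 <= p <= r)%N -> (0 < N p)%N
    & forall p j, (1 <= p <= r)%N -> (j < N p)%N -> h p j ^+ 2 + g p j ^+ 2 = 1].
Proof.
have [rs rs1] := symmetric_eigenspaces (neg_sqr_skew_sym AT).
(* Sorted decreasingly without repetition, so that [lam] strictly decreases; discarding zero
   eigenspaces makes [N p] positive for [p] from 1 to [r]. *)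
pose as_ : seq R := rev (sort <=%R (undup
    [seq a <- rs | (0 < a < 4) && (eigenspace S a != 0)])).
pose r := size as_; pose a p : R := nth 0 as_ p.
have aP p : (p < r)%N -> [/\ 0 < a p, a p < 4 & eigenspace S (a p) != 0].
  move=> /(mem_nth 0); rewrite mem_rev mem_sort mem_undup mem_filter.
  by move=> /andP[/andP[/andP[]]].
have a_lt p : (p.+1 < r)%N -> a p.+1 < a p.
  have /(sortedP 0) : sorted >%R as_; last by apply.
  by rewrite rev_sorted sort_lt_sorted undup_uniq.
have a_inj p q : (p < r)%N -> (q < r)%N -> p != q -> a p != a q.
  by move=> pr qr; rewrite nth_uniq// rev_uniq sort_uniq undup_uniq.
have [n0 [Y0 [Y01 Y0S Y0A Y0A0 rk0]]] := adapted_involution AT KT KK.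
have [m [Z [Z1 ZS ZA ZA0 rkZ]]] := adapted_kernel AT KT KK.
pose T k := 'M[R]_(2 * k + 2 * k, n).
(* The block size depends on [p], so the bases are chosen in a sigma type; indices from [r] on
   receive an empty matrix. *)
have /choice[f fP] : forall p : nat, exists y : {k & T k},
    (p < r)%N -> adapted A K (a p)
      (Num.sqrt (a p) *: skew_unit R (2 * tag y))
      (A0_block (tag y) (Num.sqrt (a p)) (fun=> 1) (fun=> 0)) (tagged y).
  move=> p; have [/aP[a0 a4 _]|_] := ltnP p r; last by exists (existT T 0%N 0).
  by have [k [Y ?]] := adapted_quaternionic AT KT KA KK a0 a4; exists (existT T k Y).
(* Index 0 is reserved for the eigenvalue 4, whose square root is [lam 0]; block [p.+1] comes from
   [a p]. *)
pose N p := if p is q.+1 then tag (f q) else n0.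
pose lam p : R := if p is q.+1 then Num.sqrt (a q) else 2.
pose Y (p : 'I_r) := tagged (f p).
pose B : 'M[R]_(normal_size r N m, n) := col_mx Y0 (col_mx (\mxcol_(p < r) Y p) Z).
have YP (p : 'I_r) := fP p (ltn_ord p).
have ar_neq (p : 'I_r) : (4 != a p) * (a p != 4) * (a p != 0) * (0 != a p).
  have [a0 a4 _] := aP p (ltn_ord p).
  by rewrite !(lt_eqF a0, lt_eqF a4, gt_eqF a0, gt_eqF a4).
have n4 : (4 != 0 :> R) * (0 != 4 :> R) by split; rewrite ?(eq_sym 0) pnatr_eq0.
have B1 : B *m B^T = 1%:M.
  have tr0 k l (V : 'M[R]_(k, n)) (W : 'M[R]_(l, n)) : V *m W^T = 0 -> W *m V^T = 0.
    by move=> VW; rewrite -[LHS]trmxK trmx_mul trmxK VW trmx0.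
  pose YY := \mxcol_(p < r) Y p.
  have YY1 : YY *m YY^T = 1%:M.
    rewrite tr_mxcol mul_mxcol_mxrow -mxdiagZ; apply: eq_mxblock => p q.
    have [Yp1 YpS _ _ _] := YP p; have [_ YqS _ _ _] := YP q.
    case: eqVneq YqS => [<-|pq] YqS; first by rewrite conform_mx_id.
    by apply: eigenrows_orthogonal YpS YqS; apply: a_inj.
  have Y0YY : Y0 *m YY^T = 0.
    rewrite tr_mxcol mul_mxrow -mxrow0; apply: eq_mxrow => p.
    by have [_ YpS _ _ _] := YP p; rewrite (eigenrows_orthogonal _ Y0S YpS) ?ar_neq.
  have YYZ : YY *m Z^T = 0.
    rewrite mxcol_mul -mxcol0; apply: eq_mxcol => p.
    by have [_ YpS _ _ _] := YP p; rewrite (eigenrows_orthogonal _ YpS ZS) ?ar_neq.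
  have Y0Z : Y0 *m Z^T = 0 by rewrite (eigenrows_orthogonal _ Y0S ZS) ?n4.
  rewrite !tr_col_mx mul_col_row mul_mx_row mul_col_mx mul_col_row Y01 YY1 Z1.
  rewrite Y0Z Y0YY YYZ (tr0 _ _ _ _ Y0Z) (tr0 _ _ _ _ Y0YY) (tr0 _ _ _ _ YYZ).
  rewrite row_mx0 col_mx0.
  by rewrite -!scalar_mx_block.
exists r, lam, N, (fun _ _ => 1), (fun _ _ => 0), m, B; split; last first.
- by move=> *; rewrite expr1n expr0n addr0.
- move=> [//|p] /andP[_ pr]; have [_ _ S0] := aP p pr.
  have [_ _ _ _] := fP p pr; rewrite lt0n; apply: contraTneq => /= ->.
  by rewrite -ltnNge lt0n mxrank_eq0.
- split=> //.
  + move=> [|p] pr /=; last by rewrite ltr_sqrt ?a_lt//; have [] := aP p (ltnW pr).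
    have [a0 a4 _] := aP 0%N pr; rewrite -(@ger0_norm _ 2)// -sqrtr_sqr ltr_sqrt//.
    by rewrite (lt_le_trans a4)// -natrX.
  + rewrite /lam; case E : r => [//|p]; rewrite sqrtr_gt0.
    by have [] := aP p; rewrite ?E.
split=> //.
- rewrite /normal_A1 /dsum_mx mul_col_mx mul_block_col !mul0mx addr0 add0r Y0A.
  rewrite mul_col_mx mul_block_col !mul0mx addr0 ZA mul0mx addr0 mxcol_mul.
  rewrite mul_mxdiag_mxcol; congr (col_mx _ (col_mx _ _)).
  by apply: eq_mxcol => p; have [] := YP p.
- rewrite /normal_A0 /dsum_mx mul_col_mx mul_block_col !mul0mx addr0 add0r Y0A0.
  rewrite mul_col_mx mul_block_col !mul0mx addr0 add0r ZA0 mxcol_mul.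
  rewrite mul_mxdiag_mxcol; congr (col_mx _ (col_mx _ _)).
  by apply: eq_mxcol => p; have [] := YP p.
(* Orthonormality bounds the number of rows by [n]. Conversely, the eigenspaces together span
   everything, and each has rank at most the size of its block. *)
apply/eqP; rewrite eqn_leq (leq_orthonormal_rows B1)/=.
rewrite -[X in (X <= _)%N](mxrank1 R n).
apply: (@leq_trans (\rank (eigenspace S 4 +
    (\sum_(p < r) eigenspace S (a p) + eigenspace S 0))%MS)).
  apply/mxrankS/(submx_trans rs1); rewrite big_seq.
  elim/big_ind: _ => [|X X' hX hX'|b b_rs]; first exact: sub0mx.
    by rewrite addsmx_sub hX.
  have [->|Sb0] := eqVneq (eigenspace S b) 0; first exact: sub0mx.
  have /andP[b0 b4] := eigenvalue_bounds AT KT KK Sb0.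
  have [->|b_neq4] := eqVneq b 4; first exact: addsmxSl.
  apply: submx_trans (addsmxSr _ _).
  have [->|b_neq0] := eqVneq b 0; first exact: addsmxSr.
  apply: submx_trans (addsmxSl _ _).
  have b_as : b \in as_.
    rewrite mem_rev mem_sort mem_undup mem_filter b_rs Sb0 !lt_def b_neq0 b0.
    by rewrite eq_sym b_neq4 b4.
  have br : (index b as_ < r)%N by rewrite index_mem.
  by rewrite (sumsmx_sup (Ordinal br))//= /a nth_index.
apply: (leq_trans (mxrank_adds_leqif _ _)); rewrite leq_add//.
apply: (leq_trans (mxrank_adds_leqif _ _)); rewrite leq_add//.
apply: (@big_ind2 _ _ (fun (X : 'M[R]_n) k => \rank X <= k)%N).
- by rewrite mxrank0.
- move=> X k X' k' hX hX'; apply: (leq_trans (mxrank_adds_leqif _ _)).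
  exact: leq_add.
- by move=> p _; have [] := YP p.
Qed.

End Assembly.

(** * From the rational curve to a quadratic matrix pencil *)

(** Otherwise the absolute value of [f / q] would eventually exceed [e], half that of the ratio of
    the leading coefficients. Squaring turns this into the positivity of the leading coefficient of
    [f^2 - e^2 q^2]. *)
Lemma size_lt_of_ratio_cvg0 (R : realType) (f q : {poly R}) :
  (forall t, ~~ root q t) -> f.[t] / q.[t] @[t --> +oo] --> (0 : R) ->
  (size f < size q)%N.
Proof.
move=> qN0 fq0; rewrite ltnNge; apply/negP => leqf.
have q0 : q != 0 by apply: contraNneq (qN0 0) => ->; rewrite root0.
have f0 : f != 0 by rewrite -size_poly_gt0 (leq_trans _ leqf)// size_poly_gt0.
pose e : R := `|lead_coef f / lead_coef q| / 2.
have e_gt0 : 0 < e.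
  by rewrite divr_gt0// normr_gt0 mulf_neq0// ?invr_neq0// lead_coef_eq0.
have lc_gt0 : 0 < lead_coef (f ^+ 2 - e ^+ 2 *: q ^+ 2).
  have e2 : e ^+ 2 != 0 by rewrite expf_neq0 ?gt_eqF.
  have s2 (p : {poly R}) : p != 0 -> size (p ^+ 2) = (size p + size p).-1.
    by move=> p0; rewrite expr2 size_mul.
  have lf2 : 0 < lead_coef f ^+ 2.
    by rewrite lt_def sqr_ge0 andbT expf_neq0// lead_coef_eq0.
  move: leqf; rewrite leq_eqVlt => /orP[/eqP sqf|ltqf]; last first.
    rewrite lead_coefDl ?lead_coef_exp// size_polyN size_scale// !s2//.
    by move: q0 ltqf; rewrite -size_poly_gt0; lia.
  (* For equal sizes, the choice of [e] leaves [1 - 1 / 4] of [lead_coef f ^+ 2]. *)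
  have cf : (f ^+ 2 - e ^+ 2 *: q ^+ 2)`_(size (f ^+ 2)).-1 = 3 / 4 * lead_coef f ^+ 2.
    rewrite coefB coefZ {2}s2// -sqf -s2// -!lead_coefE !lead_coef_exp.
    rewrite /e expr_div_n real_normK ?num_real// expr_div_n.
    have : lead_coef q != 0 by rewrite lead_coef_eq0.
    by move=> ?; field.
  have c_gt0 : 0 < 3 / 4 * lead_coef f ^+ 2 by rewrite mulr_gt0// divr_gt0.
  have sz : size (f ^+ 2 - e ^+ 2 *: q ^+ 2) = size (f ^+ 2).
    apply/eqP; rewrite eqn_leq; apply/andP; split.
      rewrite (leq_trans (size_polyD _ _))// geq_max leqnn size_polyN size_scale//.
      by rewrite !s2// sqf leqnn.
    rewrite -[X in (X <= _)%N]prednK ?size_poly_gt0 ?expf_neq0// ltnNge.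
    by apply/negP => /leq_sizeP/(_ _ (leqnn _))/eqP; rewrite cf gt_eqF.
  by rewrite lead_coefE sz cf.
have [x xP] := poly_pinfty_gt_lc lc_gt0.
have /cvgr0Pnorm_lt/(_ e e_gt0)[y [_ yP]] := fq0.
(* The convergence bound holds only for [t > y], hence the [+ 1]. *)
pose t := Num.max x (y + 1).
have := xP t; rewrite le_max lexx => /(_ isT) /(lt_le_trans lc_gt0).
have := yP t; rewrite lt_max ltrDl ltr01 orbT => /(_ isT)/=.
have qt : q.[t] != 0 by have := qN0 t; rewrite rootE.
rewrite normrM normfV ltr_pdivrMr ?normr_gt0// => lt_fq.
rewrite hornerD hornerN hornerZ !horner_exp subr_gt0 -exprMn ltNge.
rewrite -(real_normK (num_real f.[t])) -(real_normK (num_real (e * q.[t]))).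
by rewrite ler_sqr ?nnegrE// normrM (gtr0_norm e_gt0) ltW.
Qed.

Lemma cubic_matrix_eq0 (R : realType) m n (X Y Z W : 'M[R]_(m, n)) :
  (forall t : R, t ^+ 3 *: X + t ^+ 2 *: Y + t *: Z + W = 0) ->
  [/\ X = 0, Y = 0, Z = 0 & W = 0].
Proof.
move=> XYZW.
have e i j t := congr1 (fun M : 'M[R]_(m, n) => M i j) (XYZW t).
(* A cubic is determined by its values at four points. *)
by split; apply/matrixP => i j; have := e i j 0; have := e i j 1;
  have := e i j (-1); have := e i j 2; clear; rewrite !mxE; lra.
Qed.

(** Compare coefficients: that of [t^3] makes [A] skew, that of [t^2] fixes the symmetric part of
    [B] as [C = 1 + A^2 / 2], that of [t] gives the anticommutation, and the constant one reads
    [C^2 - K^2 = 1], since [K] commutes with [C]. *)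
Lemma orthogonal_quadratic_pencil (R : realType) n (A B : 'M[R]_n) :
  (forall t : R, (t ^+ 2 *: 1%:M + t *: A + B)^T *m (t ^+ 2 *: 1%:M + t *: A + B)
     = (t ^+ 2 + 1) ^+ 2 *: 1%:M) ->
  exists K : 'M[R]_n, [/\ A^T = - A, K^T = - K, K *m A = - (A *m K),
    K *m K = A *m A + 4^-1 *: (A *m A *m (A *m A)) &
    B = 1%:M + 2^-1 *: (A *m A) + K].
Proof.
move=> ABt.
have [t|AT BT AB BB] := @cubic_matrix_eq0 R n n (A + A^T)
    (B + B^T + A^T *m A - 2 *: 1%:M) (A^T *m B + B^T *m A) (B^T *m B - 1%:M).
  have tr : (t ^+ 2 *: 1%:M + t *: A + B)^T = t ^+ 2 *: 1%:M + t *: A^T + B^T.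
    by rewrite !linearD !linearZ/= trmx1.
  have := ABt t; rewrite tr !mulmxDl !mulmxDr.
  rewrite -!(scalemxAl, scalemxAr) !mul1mx !mulmx1 !scalerA => /eqP.
  rewrite -subr_eq0 => /eqP <-.
  by apply/matrixP => i j; rewrite !mxE; ring.
have {}AT : A^T = - A by apply/eqP; rewrite -addr_eq0 addrC AT.
pose K := B - (1%:M + 2^-1 *: (A *m A)).
have BE : B = 1%:M + 2^-1 *: (A *m A) + K by rewrite addrC subrK.
have KT : K^T = - K.
  apply/eqP; rewrite -addr_eq0; apply/eqP; rewrite /K linearB/= linearD/= linearZ/=.
  rewrite trmx1 trmx_mul AT mulNmx mulmxN opprK -BT AT mulNmx.
  by apply/matrixP => i j; rewrite !mxE; field.
clearbody K.
have [C CE] : exists C, C = 1%:M + 2^-1 *: (A *m A) by eexists.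
have CT : C^T = C.
  by rewrite CE linearD/= linearZ/= trmx1 trmx_mul AT mulNmx mulmxN opprK.
have CA : C *m A = A *m C.
  by rewrite CE mulmxDl mulmxDr mul1mx mulmx1 -scalemxAl -scalemxAr mulmxA.
rewrite -CE in BE; have BTE : B^T = C - K by rewrite BE linearD/= KT CT.
have KA : K *m A = - (A *m K).
  move: AB; rewrite AT BTE BE mulNmx mulmxDr mulmxBl CA => /eqP.
  by rewrite opprD addrACA addNr add0r addrC -opprD oppr_eq0 addr_eq0 => /eqP.
have KC : K *m C = C *m K.
  rewrite CE mulmxDr mulmxDl mul1mx mulmx1 -scalemxAl -scalemxAr !mulmxA KA.
  by rewrite mulNmx -[A *m K *m A]mulmxA KA mulmxN opprK mulmxA.
exists K; split=> //; last by rewrite -CE.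
move: BB; rewrite BTE BE mulmxBl !mulmxDr KC opprD addrA addrK => /eqP.
rewrite addrAC subr_eq0 => /eqP <-; rewrite CE.
rewrite mulmxDl !mulmxDr !mul1mx !mulmx1 -!scalemxAl -!scalemxAr scalerA.
by apply/matrixP => i j; rewrite !mxE; field.
Qed.

(** The value of [q] at the imaginary unit has real part [q_0 - q_2] and imaginary part [q_1]. *)
Lemma den_poles_i (R : realType) (q : {poly R}) : (size q).-1 = 2%N ->
  root (map_poly (real_complex R) q) (Complex 0 1) ->
  exists2 c, c != 0 & forall t, q.[t] = c * (t ^+ 2 + 1).
Proof.
move=> sq2; have sq : size q = 3%N by case: (size q) sq2 => // k /= ->.
rewrite rootE horner_coef size_map_poly sq !big_ord_recl big_ord0 !coef_map/=.
rewrite /bump/= expr0 mulr1 expr1 addr0 expr2 -!complexr0 => /eqP; simpc.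
move=> /eqP; rewrite eq_complex/= => /andP[/eqP q02 /eqP q1].
exists q`_2.
  by rewrite (_ : 2%N = (size q).-1) -?lead_coefE ?lead_coef_eq0 -?size_poly_gt0 sq.
move=> t; rewrite horner_coef sq !big_ord_recl big_ord0/= /bump/=.
have -> : q`_0 = q`_2 by lra.
have -> : q`_1 = 0 by lra.
ring.
Qed.

(** The frame forms the rows of [B], so [Q] is [B^T]; once [s = n], [B *m B^T = 1] also gives
    [B^T *m B = 1]. *)
Lemma orthonormal_frame_conj (R : realType) s n (E : s = n) (B : 'M[R]_(s, n))
    (A A0 : 'M[R]_n) (M M0 : 'M[R]_s) :
  B *m B^T = 1%:M -> B *m A = M *m B -> B *m A0 = M0 *m B ->
  exists Q : 'M[R]_n, orthogonal_group (n := n) Q /\ forall c t : R,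
    c *: ((t ^+ 2)%:M + t *: A + A0) =
    Q *m (c *: ((t ^+ 2)%:M + t *: castmx (E, E) M + castmx (E, E) M0)) *m Q^T.
Proof.
case: n / E B A A0 => B A A0 BB BA BA0; have BTB := mulmx1C BB.
exists B^T; rewrite !castmx_id trmxK; split=> [|c t].
  split; last by rewrite trmxK.
  by rewrite unitmx_tr; have [] := mulmx1_unit BB.
rewrite -scalemxAr -scalemxAl -mulmxA !mulmxDl -scalemxAl -BA -BA0.
by rewrite -scalar_mxC (scalemxAr t) -!mulmxDr mulmxA BTB mul1mx.
Qed.

Lemma quadratic_curve_pencil (R : realType) n (alpha : rational_curve R n) :
  curve_degree alpha = 2%N -> curve_poles alpha (Complex 0 1) ->
  curve_infty alpha = 1%:M ->
  exists A B : 'M[R]_n, forall t,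
    alpha t = (t ^+ 2 + 1)^-1 *: (t ^+ 2 *: 1%:M + t *: A + B).
Proof.
case: alpha => P q L qN0 qP Po Lo PL PL'; rewrite /curve_degree /curve_poles /=.
move=> sq2 qi L1; have [c c0 qE] := den_poles_i sq2 qi.
have sq : size q = 3%N by case: (size q) sq2 => // k /= ->.
(* Subtracting the limit at infinity leaves a fraction tending to 0, so [f i j] has degree at most
   1; its coefficients, divided by [c], are the entries of [A] and of [B - 1]. *)
pose f i j := P i j - (i == j)%:R *: q.
have fE i j t : (P i j).[t] = (i == j)%:R * q.[t] + (f i j)`_1 * t + (f i j)`_0.
  have sf : (size (f i j) <= 2)%N.
    rewrite -ltnS -sq; apply: size_lt_of_ratio_cvg0 => //.
    have PLij : (P i j).[t] / q.[t] @[t --> +oo] --> ((i == j)%:R : R).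
      rewrite (_ : _%:R = L i j); last by rewrite L1 mxE.
      rewrite (_ : (fun t => _) = (fun M : 'M[R]_n => M i j) \o curve_eval P q).
        by apply: (cvg_comp _ _ PL); exact: coord_continuous.
      by apply/funext => x /=; rewrite mxE.
    rewrite (_ : (fun t => _) = (fun t => (P i j).[t] / q.[t] - (i == j)%:R)).
      rewrite -(subrr ((i == j)%:R : R)); apply: cvgB => //; exact: cvg_cst.
    apply/funext => x; rewrite /f hornerD hornerN hornerZ mulrBl mulfK//.
    by have := qN0 x; rewrite rootE.
  have -> : P i j = f i j + (i == j)%:R *: q by rewrite subrK.
  rewrite hornerD hornerZ addrC -addrA; congr (_ + _).
  rewrite (horner_coef_wide _ sf) !big_ord_recl big_ord0 /=.
  by rewrite expr0 mulr1 expr1 addr0 addrC.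
exists (\matrix_(i, j) ((f i j)`_1 / c)),
  (\matrix_(i, j) ((i == j)%:R + (f i j)`_0 / c)).
move=> t; apply/matrixP => i j; rewrite /curve_fun/= !mxE fE qE.
have t0 : t ^+ 2 + 1 != 0 by rewrite gt_eqF// ltr_wpDl ?sqr_ge0.
by field; rewrite t0 c0.
Qed.

Theorem theorem4p15 (R : realType) (n : nat) (alpha : rational_curve R n)
    (hdeg : curve_degree alpha = 2%N)
    (hpoles : curve_poles alpha = [set Complex 0 1; Complex 0 (-1)])
    (hinfty : curve_infty alpha = 1%:M) :
  exists (Q : 'M[R]_n) (r : nat) (lam : nat -> R) (N : nat -> nat)
         (h g : nat -> nat -> R) (m : nat) (E : normal_size r N m = n),
    let A1 : 'M[R]_n := castmx (E, E) (normal_A1 r N m lam) in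
    let A0 : 'M[R]_n := castmx (E, E) (normal_A0 r N m lam h g) in
    [/\ @orthogonal_group R n Q,
        [/\ lam 0%N = 2%:R,
            forall p : nat, (p < r)%N -> lam p.+1 < lam p
          & 0 < lam r],
        forall p : nat, (1 <= p <= r)%N -> (0 < N p)%N,
        forall p j : nat, (1 <= p <= r)%N -> (j < N p)%N ->
          h p j ^+ 2 + g p j ^+ 2 = 1
      & forall t : R,
          alpha t =
          Q *m ((t ^+ 2 + 1)^-1 *: ((t ^+ 2)%:M + t *: A1 + A0)) *m Q^T].
Proof.
have [A [B alphaE]] : exists A B : 'M[R]_n, forall t,
    alpha t = (t ^+ 2 + 1)^-1 *: (t ^+ 2 *: 1%:M + t *: A + B).
  by apply: quadratic_curve_pencil => //; rewrite hpoles; left.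
have t0 (t : R) : t ^+ 2 + 1 != 0 by rewrite gt_eqF// ltr_wpDl ?sqr_ge0.
have [|K [AT KT KA KK BE]] := @orthogonal_quadratic_pencil R n A B.
  move=> t; have [_] := curve_orthogonal alpha t; rewrite -/(curve_fun alpha t) alphaE.
  rewrite [(_ *: _)^T]linearZ/= -scalemxAl -scalemxAr scalerA.
  move=> /(congr1 (GRing.scale ((t ^+ 2 + 1) ^+ 2))).
  by rewrite scalerA -invfM -expr2 mulfV ?expf_neq0// scale1r.
have [r [lam [N [h [g [m [Y [[Y1 YA YB E] lamP NP hgP]]]]]]]] :=
  skew_pair_normal_form AT KT KA KK.
have [Q [Qo QE]] := orthonormal_frame_conj E Y1 YA YB.
exists Q, r, lam, N, h, g, m, E; split=> // t.
by rewrite alphaE BE -QE scalemx1.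
Qed.
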